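(* Let $\mathcal Z_i=\{\zeta\in\mathbb R^L: H_i\zeta+q_i\ge 0\}$ ($i=1,\dots,m$) and $\mathcal Z_d=\{\zeta\in\mathbb R^L: H_d\zeta+q_d\ge 0\}$ ($d=1,\dots,D$), where $H_i,H_d\in\mathbb R^{K\times L}$ and $q_i,q_d\in\mathbb R^K$. Then the first stage robust SBM model with these polyhedral uncertainty sets is equivalent to the following linear optimization problem: $$\max\ w_k^1$$ subject to $$w_k^1-p_1-\frac1D\sum_{d=1}^{D}b_{dk}\le 0,\qquad p_1-\frac1m\sum_{i=1}^{m}a_{ik}\le 1,$$ $$-p_1x_{ik}^0+\sum_{j=1}^{n}x_{ij}^0\lambda_j'+S_{ik}^-+\sum_{k_1=1}^{K}q_i^{k_1}\nu_{i,k_1}\le 0\ \ \forall i,\qquad \sum_{k_1=1}^{K}h^i_{\ell k_1}\nu_{i,k_1}+\sum_{j=1}^{n}x_{ij}^\ell\lambda_j'-p_1x_{ik}^\ell=0\ \ \forall i,\ell,$$ $$p_1z_{dk}^0-\sum_{j=1}^{n}z_{dj}^0\lambda_j'+S_{dk}+\sum_{k_1=1}^{K}q_d^{k_1}\nu^1_{d,k_1}\le 0\ \ \forall d,\qquad \sum_{k_1=1}^{K}h^d_{\ell k_1}\nu^1_{d,k_1}+p_1z_{dk}^\ell-\sum_{j=1}^{n}z_{dj}^\ell\lambda_j'=0\ \ \forall d,\ell,$$ $$z_{dk}^0b_{dk}-S_{dk}+\sum_{k_1=1}^{K}q_d^{k_1}\nu^2_{d,k_1}\le 0\ \ \forall d,\qquad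 \sum_{k_1=1}^{K}h^d_{\ell k_1}\nu^2_{d,k_1}+z_{dk}^\ell b_{dk}=0\ \ \forall d,\ell,$$ $$x_{ik}^0a_{ik}-S_{ik}^-+\sum_{k_1=1}^{K}q_i^{k_1}\nu^3_{i,k_1}\le 0\ \ \forall i,\qquad \sum_{k_1=1}^{K}h^i_{\ell k_1}\nu^3_{i,k_1}+x_{ik}^\ell a_{ik}=0\ \ \forall i,\ell,$$ $$p_1-\sum_{j=1}^{n}\lambda_j'=0,\quad p_1>0,\quad\lambda_j'\ge 0\ \forall j,\quad S_{ik}^-\ge 0\ \forall i,\quad S_{dk}\ge 0\ \forall d,\quad \nu,\nu^1,\nu^2,\nu^3\ge 0,$$ where $\nu_{i,k_1},\nu^1_{d,k_1},\nu^2_{d,k_1},\nu^3_{i,k_1}$ are auxiliary (dual) variables. (Equivalent: a point $(w_k^1,p_1,\lambda',S^-,a,S,b)$ is feasible for the robust model if and only if it can be completed by values of the auxiliary variables to a feasible point of the linear problem; the objectives coincide.)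
   Context: There are $n$ decision-making units $DMU_1,\dots,DMU_n$, and $k\in\{1,\dots,n\}$ is fixed. Inputs $x_{ij}$ ($i=1,\dots,m$) and intermediates $z_{dj}$ ($d=1,\dots,D$) of $DMU_j$ depend affinely on a perturbation vector $\zeta\in\mathbb R^L$: $x_{ij}(\zeta)=x_{ij}^0+\sum_{\ell=1}^L\zeta_\ell x_{ij}^\ell$, $z_{dj}(\zeta)=z_{dj}^0+\sum_{\ell=1}^L\zeta_\ell z_{dj}^\ell$, with real nominal values and deviations. $h^i_{\ell k_1}$ (resp. $h^d_{\ell k_1}$) denotes the entry of $H_i$ (resp. $H_d$) in row $k_1\in\{1,\dots,K\}$ and column $\ell\in\{1,\dots,L\}$; $q_i^{k_1},q_d^{k_1}$ denote the $k_1$-th coordinates of $q_i,q_d$. The first stage robust SBM model with uncertainty sets $\mathcal Z_i,\mathcal Z_d\subset\mathbb R^L$ is: maximize $w_k^1$ subject to - $w_k^1-p_1-\frac1D\sum_{d}b_{dk}\le 0$ and $p_1-\frac1m\sum_{i}a_{ik}\le 1$; - $-\big(p_1x_{ik}(\zeta)-\sum_{j}x_{ij}(\zeta)\lambda_j'-S_{ik}^-\big)\le 0$ for all $\zeta\in\mathcal Z_i$, for every $i$; - $p_1z_{dk}(\zeta)-\sum_{j}z_{dj}(\zeta)\lambda_j'+S_{dk}\le 0$ for all $\zeta\in\mathcal Z_d$, for every $d$; - $z_{dk}(\zeta)b_{dk}-S_{dk}\le 0$ for all $\zeta\in\mathcal Z_d$, for every $d$; - $x_{ik}(\zeta)a_{ik}-S_{ik}^-\le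 0$ for all $\zeta\in\mathcal Z_i$, for every $i$; - $p_1-\sum_j\lambda_j'=0$, $p_1>0$, $\lambda_j'\ge 0$, $S_{ik}^-\ge 0$, $S_{dk}\ge 0$. Decision variables: real $w_k^1,p_1,\lambda_j',S_{ik}^-,a_{ik},S_{dk},b_{dk}$.
   Formalization: The formal theorem additionally assumes that every uncertainty set Z_i and Z_d is nonempty; without this the claimed equivalence can fail, since the robust constraints become vacuous while the dual equations may be unsolvable. *)

(* Defs.v *)
From HB Require Import structures.
From mathcomp Require Import all_boot all_order all_algebra.

Set Implicit Arguments.
Unset Strict Implicit.
Unset Printing Implicit Defensive.

Import Order.TTheory GRing.Theory Num.Theory.
Local Open Scope ring_scope.

Record max_problem (R T : Type) := MaxProblem {
  feasible : T -> Prop;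
  objective : T -> R
}.

(* P and Q are equivalent, Q having auxiliary variables in A on top of the    *)
(* variables of P: the feasible set of P is the projection of that of Q, and  *)
(* the objectives coincide.                                                   *)
Definition equivalent_up_to_aux (R T A : Type)
    (P : max_problem R T) (Q : max_problem R (T * A)) : Prop :=
  (forall v, feasible P v <-> exists y, feasible Q (v, y)) /\
  (forall v y, objective Q (v, y) = objective P v).

(* Rows are inputs (resp. intermediates), columns are decision-making units;  *)
(* xdev l and zdev l are the deviations along the l-th perturbation.          *)
Record sbm_data (R : realFieldType) (m D n L : nat) := SbmData {
  x0 : 'M[R]_(m, n);
  xdev : 'I_L -> 'M[R]_(m, n);
  z0 : 'M[R]_(D, n);
  zdev : 'I_L -> 'M[R]_(D, n)
}.

Definition xval (R : realFieldType) (m D n L : nat) (dat : sbm_data R m D n L)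
    (zeta : 'cV[R]_L) (i : 'I_m) (j : 'I_n) : R :=
  x0 dat i j + \sum_(l < L) zeta l 0 * xdev dat l i j.

Definition zval (R : realFieldType) (m D n L : nat) (dat : sbm_data R m D n L)
    (zeta : 'cV[R]_L) (d : 'I_D) (j : 'I_n) : R :=
  z0 dat d j + \sum_(l < L) zeta l 0 * zdev dat l d j.

(* The decision variables w_k^1, p_1, lambda', S^-_{ik}, a_{ik}, S_{dk},      *)
(* b_{dk}; the evaluated unit k is fixed and does not index them.             *)
Record sbm_vars (R : realFieldType) (m D n : nat) := SbmVars {
  var_w : R;
  var_p : R;
  var_lam : 'I_n -> R;
  var_Sx : 'I_m -> R;
  var_a : 'I_m -> R;
  var_Sz : 'I_D -> R;
  var_b : 'I_D -> R
}.

Definition robust_feasible (R : realFieldType) (m D n L : nat) (k : 'I_n)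
    (dat : sbm_data R m D n L)
    (Zx : 'I_m -> 'cV[R]_L -> Prop) (Zz : 'I_D -> 'cV[R]_L -> Prop)
    (v : sbm_vars R m D n) : Prop :=
  let: SbmVars w p lam Sx a Sz b := v in
  let x := xval dat in let z := zval dat in
  [/\ w - p - D%:R^-1 * (\sum_(d < D) b d) <= 0 /\
      p - m%:R^-1 * (\sum_(i < m) a i) <= 1,
      forall i zeta, Zx i zeta ->
        - (p * x zeta i k - \sum_(j < n) x zeta i j * lam j - Sx i) <= 0,
      forall d zeta, Zz d zeta ->
        p * z zeta d k - \sum_(j < n) z zeta d j * lam j + Sz d <= 0,
      (forall d zeta, Zz d zeta -> z zeta d k * b d - Sz d <= 0) /\
      (forall i zeta, Zx i zeta -> x zeta i k * a i - Sx i <= 0)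
    & [/\ p - \sum_(j < n) lam j = 0, 0 < p, forall j, 0 <= lam j,
          forall i, 0 <= Sx i & forall d, 0 <= Sz d]].

Definition robust_sbm (R : realFieldType) (m D n L : nat) (k : 'I_n)
    (dat : sbm_data R m D n L)
    (Zx : 'I_m -> 'cV[R]_L -> Prop) (Zz : 'I_D -> 'cV[R]_L -> Prop) :
    max_problem R (sbm_vars R m D n) :=
  MaxProblem (robust_feasible k dat Zx Zz) (@var_w R m D n).

Definition polyhedron (R : realFieldType) (K L : nat)
    (H : 'M[R]_(K, L)) (q : 'cV[R]_K) (zeta : 'cV[R]_L) : Prop :=
  forall k1, 0 <= (H *m zeta + q) k1 0.

Record dual_vars (R : realFieldType) (m D K : nat) := DualVars {
  var_nu : 'I_m -> 'I_K -> R;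
  var_nu1 : 'I_D -> 'I_K -> R;
  var_nu2 : 'I_D -> 'I_K -> R;
  var_nu3 : 'I_m -> 'I_K -> R
}.

Definition linear_feasible (R : realFieldType) (m D n L K : nat) (k : 'I_n)
    (dat : sbm_data R m D n L)
    (Hx : 'I_m -> 'M[R]_(K, L)) (qx : 'I_m -> 'cV[R]_K)
    (Hz : 'I_D -> 'M[R]_(K, L)) (qz : 'I_D -> 'cV[R]_K)
    (vy : sbm_vars R m D n * dual_vars R m D K) : Prop :=
  let: (SbmVars w p lam Sx a Sz b, DualVars nu nu1 nu2 nu3) := vy in
  [/\ [/\ w - p - D%:R^-1 * (\sum_(d < D) b d) <= 0,
          p - m%:R^-1 * (\sum_(i < m) a i) <= 1,
          forall i, - p * x0 dat i k + \sum_(j < n) x0 dat i j * lam j + Sx i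
                    + \sum_(k1 < K) qx i k1 0 * nu i k1 <= 0
        & forall i l, \sum_(k1 < K) Hx i k1 l * nu i k1
                      + \sum_(j < n) xdev dat l i j * lam j
                      - p * xdev dat l i k = 0],
      (forall d, p * z0 dat d k - \sum_(j < n) z0 dat d j * lam j + Sz d
                 + \sum_(k1 < K) qz d k1 0 * nu1 d k1 <= 0) /\
      (forall d l, \sum_(k1 < K) Hz d k1 l * nu1 d k1
                   + p * zdev dat l d k
                   - \sum_(j < n) zdev dat l d j * lam j = 0),
      [/\ forall d, z0 dat d k * b d - Sz d
                    + \sum_(k1 < K) qz d k1 0 * nu2 d k1 <= 0,
          forall d l, \sum_(k1 < K) Hz d k1 l * nu2 d k1
                      + zdev dat l d k * b d = 0,
          forall i, x0 dat i k * a i - Sx i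
                    + \sum_(k1 < K) qx i k1 0 * nu3 i k1 <= 0
        & forall i l, \sum_(k1 < K) Hx i k1 l * nu3 i k1
                      + xdev dat l i k * a i = 0],
      [/\ p - \sum_(j < n) lam j = 0, 0 < p, forall j, 0 <= lam j,
          forall i, 0 <= Sx i & forall d, 0 <= Sz d]
    & [/\ forall i k1, 0 <= nu i k1, forall d k1, 0 <= nu1 d k1,
          forall d k1, 0 <= nu2 d k1 & forall i k1, 0 <= nu3 i k1]].

Definition linear_sbm (R : realFieldType) (m D n L K : nat) (k : 'I_n)
    (dat : sbm_data R m D n L)
    (Hx : 'I_m -> 'M[R]_(K, L)) (qx : 'I_m -> 'cV[R]_K)
    (Hz : 'I_D -> 'M[R]_(K, L)) (qz : 'I_D -> 'cV[R]_K) :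
    max_problem R (sbm_vars R m D n * dual_vars R m D K) :=
  MaxProblem (linear_feasible k dat Hx qx Hz qz) (fun vy => var_w vy.1).

(* Main.v *)
Require Import Defs.
From HB Require Import structures.
From mathcomp Require Import all_boot all_order all_algebra.
From mathcomp Require Import ring lra.

(** A constraint of the robust model asks an affine function of the
    perturbation zeta to be nonpositive on a polyhedron H zeta + q >= 0; the
    decision variables enter its constant term and its linear coefficients,
    in a linear way.  Linear programming duality says that an affine function is
    nonpositive on a nonempty polyhedron exactly when it is a nonpositive
    constant minus a combination of the forms H zeta + q with coefficients
    nu >= 0.  Comparing constant terms and linear coefficients gives one
    inequality and L equations; these are the rows of the linear problem, with
    nu as the auxiliary variables of that constraint.  The theorem follows by
    doing this for the four families of robust constraints, each constraint
    having its own multipliers.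

    Duality is derived here over an arbitrary ordered field, where closed
    bounded sets need not be compact and separating hyperplanes must be found
    algebraically.  Farkas' lemma ([farkas]) is proved by induction on the
    number of generators of the cone: when the functional found for all but one
    of them is negative on the last one, everything is projected along that
    last generator.  The affine version ([affine_farkas]) follows by homogenizing: a
    separating vector has a last coordinate t >= 0, and gives a violating point
    of the polyhedron when t > 0, or a violating recession direction when
    t = 0.  The second case needs a point of the polyhedron to start from, and
    there nonemptiness enters. *)

Set Implicit Arguments.
Unset Strict Implicit.
Unset Printing Implicit Defensive.

Import Order.TTheory GRing.Theory Num.Theory.
Local Open Scope ring_scope.

Lemma addmx_entry (R : nmodType) (m n : nat) (A B : 'M[R]_(m, n)) i j :
  (A + B) i j = A i j + B i j.
Proof. by rewrite mxE. Qed.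

Lemma oppmx_entry (R : zmodType) (m n : nat) (A : 'M[R]_(m, n)) i j :
  (- A) i j = - A i j.
Proof. by rewrite mxE. Qed.

Lemma scalemx_entry (R : pzRingType) (m n : nat) (a : R) (A : 'M[R]_(m, n)) i j :
  (a *: A) i j = a * A i j.
Proof. by rewrite mxE. Qed.

Lemma scalar_mx11_entry (R : pzRingType) (a : R) : (a%:M : 'M_1) 0 0 = a.
Proof. by rewrite mxE eqxx mulr1n. Qed.

Lemma mulmx_rV_cV_ge0 (R : realFieldType) (K : nat)
    (nu : 'rV[R]_K) (v : 'cV[R]_K) :
  (forall k, 0 <= nu 0 k) -> (forall k, 0 <= v k 0) -> 0 <= (nu *m v) 0 0.
Proof. by move=> nu0 v0; rewrite mxE sumr_ge0 // => k _; rewrite mulr_ge0. Qed.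

(** Either c lies in the cone spanned by the rows of A or some hyperplane
    separates it from that cone.  Adding a generator a matters only if the
    functional y found for the others has a y < 0.  Then
    P = 1 - y a / (a y), which satisfies a P = 0, reduces the problem to the
    remaining generators: a separating y' for A P and c P yields P y' for A and
    c, and a combination nu A P = c P makes c - nu A a multiple of a, whose
    coefficient is a quotient of two negative numbers. *)
Lemma farkas (R : realFieldType) (K N : nat) (A : 'M[R]_(K, N)) (c : 'rV[R]_N) :
  (exists2 nu : 'rV[R]_K, forall k, 0 <= nu 0 k & nu *m A = c) \/
  (exists2 y : 'cV[R]_N, forall k, 0 <= (A *m y) k 0 & (c *m y) 0 0 < 0).
Proof.
elim: K A c => [|K IHK] A c; last rewrite -[K.+1]/(1 + K)%N in A *.
  have [->|c_neq0] := eqVneq c 0.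
    by left; exists 0; [case | rewrite mul0mx].
  (* The cone is reduced to 0: the functional - c^T separates it from c. *)
  right; exists (- c^T); first by case.
  have sq_ge0 j : true -> 0 <= c 0 j * c 0 j by rewrite -expr2 sqr_ge0.
  have -> : (c *m - c^T) 0 0 = - \sum_j c 0 j * c 0 j.
    by rewrite mulmxN !mxE; congr (- _); apply: eq_bigr => j _; rewrite mxE.
  rewrite oppr_lt0 lt_def sumr_ge0 // andbT; apply: contra c_neq0.
  rewrite psumr_eq0 // => /allP c0; apply/eqP/rowP => j; rewrite mxE.
  by apply/eqP; have := c0 j (mem_index_enum _); rewrite /= mulf_eq0 orbb.
rewrite -[A]vsubmxK; move: (usubmx A) (dsubmx A) => a B {A}.
have [[nu nu_ge0 nuB]|[y By_ge0 cy_lt0]] := IHK B c.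
  left; exists (row_mx 0 nu); last by rewrite mul_row_col mul0mx add0r.
  by move=> k; rewrite mxE; case: splitP => j _; rewrite ?mxE.
have [ay_ge0|ay_lt0] := lerP 0 ((a *m y) 0 0).
  right; exists y => // k; rewrite mul_col_mx mxE.
  by case: splitP => j _ //; rewrite ord1.
set s := (a *m y) 0 0 in ay_lt0.
have s_neq0 : s != 0 by rewrite lt_eqF.
pose P : 'M[R]_N := 1%:M - s^-1 *: (y *m a).
have aP0 : a *m P = 0.
  rewrite mulmxBr mulmx1 -scalemxAr mulmxA [a *m y]mx11_scalar -/s.
  by rewrite mul_scalar_mx scalerA mulVf // scale1r subrr.
have [[nu nu_ge0 nuBP]|[y' BPy'_ge0 cPy'_lt0]] := IHK (B *m P) (c *m P).
  left; pose r := s^-1 * ((c - nu *m B) *m y) 0 0.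
  exists (row_mx r%:M nu); last first.
    have : (c - nu *m B) *m P = 0 by rewrite mulmxBl -mulmxA nuBP subrr.
    rewrite mulmxBr mulmx1 -scalemxAr mulmxA.
    rewrite [_ *m y]mx11_scalar mul_scalar_mx scalerA -/r => /eqP.
    rewrite subr_eq0 => /eqP defc.
    by rewrite mul_row_col mul_scalar_mx -defc subrK.
  move=> k; rewrite mxE; case: splitP => j _ //; rewrite ord1 scalar_mx11_entry.
  have := mulmx_rV_cV_ge0 nu_ge0 By_ge0; rewrite mulmxA => nuBy_ge0.
  rewrite /r mulr_le0 ?invr_le0 ?ltW // mulmxBl addmx_entry oppmx_entry.
  by rewrite ltrBlDr ltr_wpDr.
right; exists (P *m y'); last by rewrite mulmxA.
move=> k; rewrite mul_col_mx !mulmxA aP0 mul0mx mxE.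
by case: splitP => j _; [rewrite mxE | exact: BPy'_ge0].
Qed.

(** Homogenization: the form H zeta + q t, together with t itself, generates the
    cone to which Farkas' lemma is applied, and the multiplier of t is the
    slack of the inequality between constant terms. *)
Lemma affine_farkas (R : realFieldType) (K L : nat)
    (H : 'M[R]_(K, L)) (q : 'cV[R]_K) (c0 : R) (c : 'rV[R]_L) :
  (exists zeta, polyhedron H q zeta) ->
  (forall zeta, polyhedron H q zeta -> c0 + (c *m zeta) 0 0 <= 0) <->
  (exists nu : 'rV[R]_K,
     [/\ forall k, 0 <= nu 0 k, c0 + (nu *m q) 0 0 <= 0 & nu *m H + c = 0]).
Proof.
move=> [zeta0 zeta0P]; split=> [robust|[nu [nu_ge0 c0_le defc]] zeta zetaP].
  pose A : 'M[R]_(K + 1, L + 1) := block_mx H q 0 1%:M.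
  have [[nu nu_ge0 nuA]|[y Ay_ge0 cy_lt0]] := farkas A (- row_mx c c0%:M).
    exists (lsubmx nu).
    have r_ge0 : 0 <= rsubmx nu 0 0 by rewrite mxE.
    move: nuA; rewrite -{1}[nu]hsubmxK mul_row_block mulmx0 mulmx1 addr0.
    rewrite opp_row_mx => /eq_row_mx[nuH nuq]; split=> [k||].
    - by rewrite mxE.
    - have := congr1 (fun M : 'M_1 => M 0 0) nuq.
      by rewrite /= addmx_entry oppmx_entry scalar_mx11_entry; lra.
    - by rewrite nuH addNr.
  exfalso; move: Ay_ge0 cy_lt0; rewrite -[y]vsubmxK.
  move: (usubmx y) (dsubmx y) => zeta u {y}.
  rewrite [u]mx11_scalar; move: (u 0 0) => t {u}.
  rewrite mul_block_col mul0mx mul1mx add0r mulNmx mul_row_col => Ay_ge0.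
  rewrite -scalar_mxM oppmx_entry addmx_entry scalar_mx11_entry => cy_lt0.
  have dirP k : 0 <= (H *m zeta) k 0 + q k 0 * t.
    have := Ay_ge0 (lshift 1 k); rewrite col_mxEu mul_mx_scalar.
    by rewrite addmx_entry scalemx_entry [t * _]mulrC.
  have t_ge0 : 0 <= t.
    by have := Ay_ge0 (rshift K 0); rewrite col_mxEd mxE eqxx.
  have [t0|t_neq0] := eqVneq t 0; last first.
    have t_gt0 : 0 < t by rewrite lt_def t_neq0.
    have zetaP : polyhedron H q (t^-1 *: zeta).
      move=> k; rewrite -scalemxAr addmx_entry scalemx_entry.
      rewrite -(pmulr_rge0 _ t_gt0) mulrDr mulrA divff //.
      by rewrite mul1r [t * _]mulrC.
    have := robust _ zetaP; rewrite -scalemxAr scalemx_entry.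
    rewrite -(pmulr_rle0 _ t_gt0) mulrDr mulrA divff // mul1r.
    by move: cy_lt0; rewrite [t * _]mulrC; lra.
  move: cy_lt0 dirP; rewrite {}t0 mulr0 addr0 oppr_lt0 => cz_gt0 dirP.
  (* A recession direction along which c increases: moving from zeta0 by *)
  (* this amount makes c0 + c zeta at least 1. *)
  pose s := (`|c0 + (c *m zeta0) 0 0| + 1) / (c *m zeta) 0 0.
  have s_ge0 : 0 <= s by rewrite divr_ge0 ?addr_ge0 // ltW.
  have zetaP : polyhedron H q (zeta0 + s *: zeta).
    move=> k; have := zeta0P k; have := dirP k.
    rewrite mulr0 addr0 => /(mulr_ge0 s_ge0).
    by rewrite mulmxDr -scalemxAr !addmx_entry scalemx_entry; lra.
  have := robust _ zetaP; rewrite mulmxDr -scalemxAr addmx_entry scalemx_entry.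
  rewrite divfK ?gt_eqF //.
  by have := ler_norm (- (c0 + (c *m zeta0) 0 0)); rewrite normrN; lra.
have := mulmx_rV_cV_ge0 nu_ge0 zetaP.
have -> : c = - (nu *m H) by apply/eqP; rewrite -addr_eq0 addrC defc.
by rewrite mulNmx mulmxDr mulmxA addmx_entry oppmx_entry; lra.
Qed.

(** The duality in the coordinates of the model, for a finite family of
    constraints.  The constraints share the decision variables but no
    multipliers, so the multipliers can be chosen constraint by constraint. *)
Lemma robust_family_dual (R : realFieldType) (I : finType) (K L : nat)
    (H : I -> 'M[R]_(K, L)) (q : I -> 'cV[R]_K)
    (f : I -> 'cV[R]_L -> R) (c0 : I -> R) (c : I -> 'I_L -> R) :
    (forall i, exists zeta, polyhedron (H i) (q i) zeta) ->
    (forall i zeta, f i zeta = c0 i + \sum_(l < L) zeta l 0 * c i l) ->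
  (forall i zeta, polyhedron (H i) (q i) zeta -> f i zeta <= 0) <->
  (exists nu : I -> 'I_K -> R,
     [/\ forall i k, 0 <= nu i k,
         forall i, c0 i + \sum_(k < K) q i k 0 * nu i k <= 0
       & forall i l, \sum_(k < K) H i k l * nu i k + c i l = 0]).
Proof.
move=> nonempty fE.
have fE' i zeta : f i zeta = c0 i + ((\row_l c i l) *m zeta) 0 0.
  by rewrite fE mxE; congr (_ + _); apply: eq_bigr => l _; rewrite mxE mulrC.
split=> [robust|[nu [nu_ge0 c0_le defc]] i zeta].
  have /fin_all_exists[nu nuP] i : exists nu : 'I_K -> R,
      [/\ forall k, 0 <= nu k, c0 i + \sum_(k < K) q i k 0 * nu k <= 0
        & forall l, \sum_(k < K) H i k l * nu k + c i l = 0].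
    have /(affine_farkas (c0 i) (\row_l c i l) (nonempty i)) :
        forall zeta, polyhedron (H i) (q i) zeta ->
        c0 i + ((\row_l c i l) *m zeta) 0 0 <= 0.
      by move=> zeta /robust; rewrite fE'.
    move=> [nu [nu_ge0 c0_le /rowP defc]]; exists (nu 0); split=> // [|l].
      by under eq_bigr do rewrite mulrC; rewrite mxE in c0_le.
    by have := defc l; rewrite !mxE; under eq_bigr do rewrite mulrC.
  by exists nu; split=> i; have [] := nuP i.
rewrite fE'; apply: (affine_farkas _ _ (nonempty i)).2.
exists (\row_k nu i k); split=> [k||]; first by rewrite mxE.
  by rewrite mxE; under eq_bigr do rewrite mxE mulrC.
apply/rowP => l; rewrite !mxE -[RHS](defc i l); congr (_ + _).
by apply: eq_bigr => k _; rewrite mxE mulrC.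
Qed.

Lemma affine_mulr (R : comPzRingType) (L : nat) (zeta : 'I_L -> R)
    (y0 : R) (ydev : 'I_L -> R) (r : R) :
  (y0 + \sum_(l < L) zeta l * ydev l) * r
  = y0 * r + \sum_(l < L) zeta l * (ydev l * r).
Proof.
rewrite mulrDl mulr_suml; congr (_ + _).
by apply: eq_bigr => l _; rewrite mulrA.
Qed.

Lemma affine_combination (R : comPzRingType) (n L : nat) (zeta : 'I_L -> R)
    (y0 : 'I_n -> R) (ydev : 'I_L -> 'I_n -> R) (lam : 'I_n -> R) :
  \sum_(j < n) (y0 j + \sum_(l < L) zeta l * ydev l j) * lam j
  = \sum_(j < n) y0 j * lam j
    + \sum_(l < L) zeta l * \sum_(j < n) ydev l j * lam j.
Proof.
under eq_bigr do rewrite affine_mulr.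
rewrite big_split exchange_big /=; congr (_ + _).
by apply: eq_bigr => l _; rewrite mulr_sumr.
Qed.

(** Both families of constraints comparing the evaluated unit, scaled by p,
    with a combination of all units bound this gap, from below for inputs and
    from above for intermediates. *)
Lemma affine_gap (R : comPzRingType) (n L : nat) (zeta : 'I_L -> R)
    (y0 : 'I_n -> R) (ydev : 'I_L -> 'I_n -> R) (lam : 'I_n -> R)
    (p : R) (k : 'I_n) :
  p * (y0 k + \sum_(l < L) zeta l * ydev l k)
    - \sum_(j < n) (y0 j + \sum_(l < L) zeta l * ydev l j) * lam j
  = (p * y0 k - \sum_(j < n) y0 j * lam j)
    + \sum_(l < L) zeta l * (p * ydev l k - \sum_(j < n) ydev l j * lam j).
Proof.
rewrite affine_combination [p * _]mulrC affine_mulr [y0 k * p]mulrC.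
have -> : \sum_(l < L) zeta l * (p * ydev l k - \sum_(j < n) ydev l j * lam j)
    = \sum_(l < L) zeta l * (ydev l k * p)
      - \sum_(l < L) zeta l * \sum_(j < n) ydev l j * lam j.
  by rewrite -sumrB; apply: eq_bigr => l _; rewrite mulrBr [p * _]mulrC.
ring.
Qed.

Theorem theorem8 (R : realFieldType) (m D n L K : nat) (k : 'I_n)
    (dat : sbm_data R m D n L)
    (Hx : 'I_m -> 'M[R]_(K, L)) (qx : 'I_m -> 'cV[R]_K)
    (Hz : 'I_D -> 'M[R]_(K, L)) (qz : 'I_D -> 'cV[R]_K)
    (Zx_nonempty : forall i, exists zeta, polyhedron (Hx i) (qx i) zeta)
    (Zz_nonempty : forall d, exists zeta, polyhedron (Hz d) (qz d) zeta) :
  equivalent_up_to_aux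
    (robust_sbm k dat (fun i => polyhedron (Hx i) (qx i))
                      (fun d => polyhedron (Hz d) (qz d)))
    (linear_sbm k dat Hx qx Hz qz).
Proof.
split=> [[w p lam Sx a Sz b]|//] /=.
have dual_x := robust_family_dual
  (f := fun i zeta => - (p * xval dat zeta i k
                         - \sum_(j < n) xval dat zeta i j * lam j - Sx i))
  (c0 := fun i => - p * x0 dat i k + \sum_(j < n) x0 dat i j * lam j + Sx i)
  (c := fun i l => \sum_(j < n) xdev dat l i j * lam j - p * xdev dat l i k)
  Zx_nonempty.
have {dual_x}/dual_x [x_to_nu nu_to_x] i zeta :
    - (p * xval dat zeta i k - \sum_(j < n) xval dat zeta i j * lam j - Sx i)
    = - p * x0 dat i k + \sum_(j < n) x0 dat i j * lam j + Sx i
      + \sum_(l < L) zeta l 0 *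
          (\sum_(j < n) xdev dat l i j * lam j - p * xdev dat l i k).
  rewrite (affine_gap _ (x0 dat i) (fun l => xdev dat l i)).
  under [X in _ = _ + X]eq_bigr do rewrite -opprB mulrN.
  by rewrite sumrN; ring.
have dual_z := robust_family_dual
  (f := fun d zeta => p * zval dat zeta d k
                      - \sum_(j < n) zval dat zeta d j * lam j + Sz d)
  (c0 := fun d => p * z0 dat d k - \sum_(j < n) z0 dat d j * lam j + Sz d)
  (c := fun d l => p * zdev dat l d k - \sum_(j < n) zdev dat l d j * lam j)
  Zz_nonempty.
have {dual_z}/dual_z [z_to_nu1 nu1_to_z] d zeta :
    p * zval dat zeta d k - \sum_(j < n) zval dat zeta d j * lam j + Sz d
    = p * z0 dat d k - \sum_(j < n) z0 dat d j * lam j + Sz d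
      + \sum_(l < L) zeta l 0 *
          (p * zdev dat l d k - \sum_(j < n) zdev dat l d j * lam j).
  by rewrite (affine_gap _ (z0 dat d) (fun l => zdev dat l d)) addrAC.
have dual_b := robust_family_dual
  (f := fun d zeta => zval dat zeta d k * b d - Sz d)
  (c0 := fun d => z0 dat d k * b d - Sz d)
  (c := fun d l => zdev dat l d k * b d) Zz_nonempty.
have {dual_b}/dual_b [b_to_nu2 nu2_to_b] d zeta :
    zval dat zeta d k * b d - Sz d
    = z0 dat d k * b d - Sz d
      + \sum_(l < L) zeta l 0 * (zdev dat l d k * b d).
  by rewrite /zval affine_mulr addrAC.
have dual_a := robust_family_dual
  (f := fun i zeta => xval dat zeta i k * a i - Sx i)
  (c0 := fun i => x0 dat i k * a i - Sx i)
  (c := fun i l => xdev dat l i k * a i) Zx_nonempty.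
have {dual_a}/dual_a [a_to_nu3 nu3_to_a] i zeta :
    xval dat zeta i k * a i - Sx i
    = x0 dat i k * a i - Sx i
      + \sum_(l < L) zeta l 0 * (xdev dat l i k * a i).
  by rewrite /xval affine_mulr addrAC.
split.
  case=> [[w_le p_le] /x_to_nu[nu [nu_ge0 nu_le nu_eq]]
         /z_to_nu1[nu1 [nu1_ge0 nu1_le nu1_eq]]
         [/b_to_nu2[nu2 [nu2_ge0 nu2_le nu2_eq]]
          /a_to_nu3[nu3 [nu3_ge0 nu3_le nu3_eq]]] signs].
  exists (DualVars nu nu1 nu2 nu3); split=> //; first split=> //.
    by move=> i l; rewrite -addrA.
  by split=> // d l; rewrite -addrA.
case=> [[nu nu1 nu2 nu3]] [[w_le p_le nu_le nu_eq] [nu1_le nu1_eq]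
  [nu2_le nu2_eq nu3_le nu3_eq] signs [nu_ge0 nu1_ge0 nu2_ge0 nu3_ge0]].
split=> //.
- by apply: nu_to_x; exists nu; split=> // i l; rewrite addrA.
- by apply: nu1_to_z; exists nu1; split=> // d l; rewrite addrA.
split; first by apply: nu2_to_b; exists nu2.
by apply: nu3_to_a; exists nu3.
Qed.
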